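(* For all integers $k,v\ge 0$ and all real $x,t$, $$\frac{\partial^{v}f_{\mathbb{B},k}(x,t)}{\partial t^{v}}=\sum_{j=0}^{v}B_j^v(x)\,f_{\mathbb{B},k-j}(x,t),$$ where $f_{\mathbb{B},k}$ is the generating function $f_{\mathbb{B},k}(x,t)=\sum_{n=0}^{\infty}B_k^n(x)\frac{t^n}{n!}$ of the Bernstein basis functions.
   Context: The Bernstein basis functions are $B_k^n(x)=\binom{n}{k}x^k(1-x)^{n-k}$ for integers $0\le k\le n$, with the convention that $B_k^n(x)=0$ when $k<0$ or $k>n$ (and $0^0=1$). In particular $f_{\mathbb{B},k}=0$ for $k<0$, and $f_{\mathbb{B},k}(x,t)=\frac{t^kx^k}{k!}e^{(1-x)t}$ for $k\ge 0$. *)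

(* Defs.v *)
From Stdlib Require Import Reals ZArith Bool Lra Lia.
From Coquelicot Require Import Coquelicot.
Open Scope R_scope.

(* The lower index ranges over Z because the identity for the generating
   functions involves negative indices k - j.  [Binomial.C] is qualified since
   Coquelicot uses [C] for the complex numbers; outside 0 <= k <= n it is not the
   usual binomial coefficient, hence the guard. *)
Definition bernstein (n : nat) (k : Z) (x : R) : R :=
  if ((0 <=? k)%Z && (k <=? Z.of_nat n)%Z)%bool then
    Binomial.C n (Z.to_nat k) * x ^ Z.to_nat k * (1 - x) ^ (n - Z.to_nat k)
  else 0.

Definition bernstein_gen_term (k : Z) (x t : R) (n : nat) : R :=
  bernstein n k x * (t ^ n / INR (fact n)).

Definition bernstein_gen (k : Z) (x t : R) : R :=
  Series (bernstein_gen_term k x t).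

(* [Series] is a total operator; this lemma shows that its value above is the
   sum of a convergent series. *)
Lemma is_series_bernstein_gen (k : Z) (x t : R) :
  is_series (bernstein_gen_term k x t) (bernstein_gen k x t).
Proof.
apply Series_correct.
destruct (Z_lt_le_dec k 0) as [hk | hk].
- apply ex_series_ext with (fun n => 0 * (1 / 2) ^ n).
  + intros n; unfold bernstein_gen_term, bernstein.
    replace (0 <=? k)%Z with false by (symmetry; apply Z.leb_gt; lia).
    simpl; ring.
  + apply (@ex_series_scal_l R_AbsRing R_NormedModule 0), ex_series_geom.
    rewrite Rabs_pos_eq; lra.
- set (m := Z.to_nat k).
  assert (hm : k = Z.of_nat m) by (unfold m; lia).
  apply <- (ex_series_incr_n (bernstein_gen_term k x t) m).
  generalize (@is_series_scal R_AbsRing R_NormedModule ((t * x) ^ m / INR (fact m))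
    _ _ (is_exp_Reals ((1 - x) * t))); intros hs.
  eexists; refine (is_series_ext _ _ _ _ hs); clear hs.
  intros i; unfold bernstein_gen_term, bernstein; fold m.
  replace (0 <=? k)%Z with true by (symmetry; apply Z.leb_le; lia).
  replace (k <=? Z.of_nat (m + i))%Z with true by (symmetry; apply Z.leb_le; lia).
  simpl andb; cbv iota.
  unfold Binomial.C.
  replace (m + i - m)%nat with i by lia.
  apply (@eq_trans R _
    ((t * x) ^ m / INR (fact m) * (((1 - x) * t) ^ i * / INR (fact i)))).
  { rewrite <- (pow_n_pow ((1 - x) * t) i); reflexivity. }
  rewrite !Rpow_mult_distr, pow_add.
  field; repeat split; apply INR_fact_neq_0.
Qed.

(* Main.v *)
Require Import Defs.
From Stdlib Require Import Reals ZArith.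
From Coquelicot Require Import Coquelicot.
From Stdlib Require Import Lra Lia.
Open Scope R_scope.

(** For fixed [k] and [x], [bernstein_gen k x] is an entire power series in [t]
    with coefficients [bernstein n k x / n!], so differentiating it shifts [n]
    to [S n].  Pascal's rule
    [bernstein (S n) k x = (1 - x) * bernstein n k x + x * bernstein n (k - 1) x]
    turns this shift into
    [d/dt bernstein_gen k x = (1 - x) * bernstein_gen k x + x * bernstein_gen (k - 1) x].
    The sum on the right-hand side of the theorem obeys the same recurrence in
    [v], again by Pascal's rule, and the theorem follows by induction on [v]. *)

Lemma bernstein_lt0 (n : nat) (k : Z) (x : R) :
  (k < 0)%Z -> bernstein n k x = 0.
Proof.
intros hk; unfold bernstein.
now replace (0 <=? k)%Z with false by (symmetry; apply Z.leb_gt; lia).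
Qed.

Lemma bernstein_gt (n : nat) (k : Z) (x : R) :
  (Z.of_nat n < k)%Z -> bernstein n k x = 0.
Proof.
intros hk; unfold bernstein.
replace (k <=? Z.of_nat n)%Z with false by (symmetry; apply Z.leb_gt; lia).
now rewrite Bool.andb_false_r.
Qed.

Lemma bernstein_of_nat (n i : nat) (x : R) :
  (i <= n)%nat ->
  bernstein n (Z.of_nat i) x = Binomial.C n i * x ^ i * (1 - x) ^ (n - i).
Proof.
intros hi; unfold bernstein.
replace (0 <=? Z.of_nat i)%Z with true by (symmetry; apply Z.leb_le; lia).
replace (Z.of_nat i <=? Z.of_nat n)%Z with true
  by (symmetry; apply Z.leb_le; lia).
now rewrite Nat2Z.id.
Qed.

Lemma bernstein_succ (n : nat) (k : Z) (x : R) :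
  bernstein (S n) k x = (1 - x) * bernstein n k x + x * bernstein n (k - 1) x.
Proof.
destruct (Z_lt_le_dec k 0) as [hneg | hpos].
{ rewrite !bernstein_lt0 by lia; ring. }
rewrite <- (Z2Nat.id k hpos); generalize (Z.to_nat k); clear k hpos; intros i.
(* [pascal] needs a lower index strictly between [0] and [S n]. At either end one term on the right
   vanishes; beyond [S n] all terms do. *)
destruct (Compare_dec.le_lt_dec i (S n)) as [hi | hi];
  [ | rewrite !bernstein_gt by lia; ring ].
destruct i as [ | i].
{ rewrite (bernstein_lt0 n (_ - 1)) by lia.
  rewrite !bernstein_of_nat, !C_n_0, !Nat.sub_0_r by lia.
  simpl; ring. }
replace (Z.of_nat (S i) - 1)%Z with (Z.of_nat i) by lia.
destruct (PeanoNat.Nat.eq_dec i n) as [-> | hne].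
{ rewrite (bernstein_gt n (Z.of_nat (S n))) by lia.
  rewrite !bernstein_of_nat, !C_n_n, !Nat.sub_diag by lia.
  simpl; ring. }
rewrite !bernstein_of_nat, <- pascal by lia.
replace (S n - S i)%nat with (S (n - S i)) by lia.
replace (n - i)%nat with (S (n - S i)) by lia.
simpl; ring.
Qed.

(** Pascal's rule splits the sum in two. The first part loses its top term [j = S v]; the second
    loses [j = 0], and shifting [j] by one turns [k] into [k - 1]. *)
Lemma bernstein_sum_succ (v : nat) (k : Z) (x : R) (g : Z -> R) :
  sum_f_R0 (fun j => bernstein (S v) (Z.of_nat j) x * g (k - Z.of_nat j)%Z) (S v) =
  (1 - x) * sum_f_R0 (fun j => bernstein v (Z.of_nat j) x * g (k - Z.of_nat j)%Z) v +
  x * sum_f_R0 (fun j => bernstein v (Z.of_nat j) x * g (k - 1 - Z.of_nat j)%Z) v.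
Proof.
rewrite (sum_eq _ (fun j =>
    bernstein v (Z.of_nat j) x * g (k - Z.of_nat j)%Z * (1 - x) +
    bernstein v (Z.of_nat j - 1) x * g (k - Z.of_nat j)%Z * x))
  by (intros j _; rewrite bernstein_succ; ring).
rewrite sum_plus, <- !scal_sum; f_equal; f_equal.
- rewrite tech5, (bernstein_gt v (Z.of_nat (S v))) by lia; ring.
- rewrite decomp_sum by lia.
  rewrite bernstein_lt0, Rmult_0_l, Rplus_0_l by lia; simpl pred.
  apply sum_eq; intros j _.
  f_equal; [f_equal | f_equal]; lia.
Qed.

Lemma is_derive_bernstein_gen (k : Z) (x t : R) :
  is_derive (bernstein_gen k x) t
    ((1 - x) * bernstein_gen k x t + x * bernstein_gen (k - 1) x t).
Proof.
set (a := fun n => bernstein n k x / INR (fact n)).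
assert (hterm : forall s n, bernstein_gen_term k x s n = a n * s ^ n).
{ intros s n; unfold bernstein_gen_term, a; field; apply INR_fact_neq_0. }
(* The series converges at [Rabs t + 1], so its terms tend to 0 there, which is impossible outside
   the disk of convergence. *)
assert (hrad : Rbar_lt (Rabs t) (CV_radius a)).
{ apply Rbar_lt_le_trans with (Rabs (Rabs t + 1)).
  { simpl; rewrite (Rabs_pos_eq (_ + 1)); generalize (Rabs_pos t); lra. }
  apply Rbar_not_lt_le; intros hlt.
  apply (CV_disk_outside _ _ hlt).
  apply is_lim_seq_ext with (1 := hterm (Rabs t + 1)).
  apply ex_series_lim_0; eexists; apply is_series_bernstein_gen. }
apply is_derive_ext with (PSeries a).
{ intros s; apply Series_ext; intros n; now rewrite hterm. }
replace (_ + _) with (PSeries (PS_derive a) t).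
{ now apply is_derive_PSeries. }
apply is_series_unique.
(* The factor [S n] from differentiation reduces [fact (S n)] to [fact n], so Pascal's rule applies
   term by term. *)
refine (is_series_ext _ _ _ _ (is_series_plus _ _ _ _
  (is_series_scal (1 - x) _ _ (is_series_bernstein_gen k x t))
  (is_series_scal x _ _ (is_series_bernstein_gen (k - 1) x t)))).
intros n; unfold PS_derive, a, bernstein_gen_term.
rewrite bernstein_succ, fact_simpl, mult_INR.
change (scal ?u ?w) with (u * w); change (plus ?u ?w) with (u + w).
match goal with |- ?u = ?w => change (@eq R u w) end.
field; split; [apply INR_fact_neq_0 | apply not_0_INR; lia].
Qed.

(** The weights do not depend on [t], so only the generating functions are differentiated;
    [bernstein_sum_succ] regroups the result. *)
Lemma is_derive_bernstein_sum (k : Z) (v : nat) (x t : R) :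
  is_derive (fun s => sum_f_R0 (fun j =>
       bernstein v (Z.of_nat j) x * bernstein_gen (k - Z.of_nat j) x s) v) t
    (sum_f_R0 (fun j =>
       bernstein (S v) (Z.of_nat j) x * bernstein_gen (k - Z.of_nat j) x t) (S v)).
Proof.
rewrite (bernstein_sum_succ v k x (fun i => bernstein_gen i x t)).
rewrite !scal_sum, <- sum_plus, <- sum_n_Reals.
apply is_derive_ext with (fun s => sum_n (fun j =>
   bernstein v (Z.of_nat j) x * bernstein_gen (k - Z.of_nat j) x s) v).
{ intros s; apply sum_n_Reals. }
apply @is_derive_sum_n; intros j _.
replace (_ + _) with (bernstein v (Z.of_nat j) x *
  ((1 - x) * bernstein_gen (k - Z.of_nat j) x t +
   x * bernstein_gen (k - Z.of_nat j - 1) x t)).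
- apply is_derive_scal, is_derive_bernstein_gen.
- replace (k - 1 - Z.of_nat j)%Z with (k - Z.of_nat j - 1)%Z by lia; ring.
Qed.

Theorem theorem8 (k : Z) (v : nat) (hk : (0 <= k)%Z) (x t : R) :
  is_derive_n (fun s : R => bernstein_gen k x s) v t
    (sum_f_R0 (fun j : nat =>
       bernstein v (Z.of_nat j) x * bernstein_gen (k - Z.of_nat j) x t) v).
Proof.
clear hk; revert t; induction v as [ | v IH]; intros t.
- simpl; rewrite Z.sub_0_r, (bernstein_of_nat 0 0), C_n_0 by lia; simpl; ring.
(* [IH] holds at every point, so the derivative of order [v] equals this sum as a function and can
   be differentiated once more. *)
- apply is_derive_ext with (fun s => sum_f_R0 (fun j =>
    bernstein v (Z.of_nat j) x * bernstein_gen (k - Z.of_nat j) x s) v).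
  + intros s; symmetry; apply is_derive_n_unique, IH.
  + apply is_derive_bernstein_sum.
Qed.
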